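(* (Affection Principle) Let $\Gamma$ be a finite connected loose graph, let $xy$ be an edge on the (distinct) vertices $x$ and $y$, and let $S$ be a subset of the vertex set. Let $k$ be any finite field, and consider the $k$-scheme $\mathcal F(\Gamma)\otimes_{\mathbb F_1}k$. Then $\bigcap_{s\in S}\mathbb A_s$ changes when one resolves the edge $xy$ only if $\bigcap_{s\in S}\mathbb A_s$ is contained in the projective subspace of $\mathbf P(\Gamma)\otimes_{\mathbb F_1}k$ generated by $\overline{\mathbf B}(x,1)\cup\overline{\mathbf B}(y,1)$.
   Context: A loose graph is a triple $(V,E,\mathbf I)$ of vertices, edges and a symmetric incidence relation between vertices and edges such that each edge is incident with at most two distinct vertices (so an edge may have two, one or no vertices); no loops, undirected. Ambient space: let $\overline\Gamma$ be the graph obtained from $\Gamma$ by adding a second, new vertex to each edge having only one vertex (and two new vertices to each edge having none), with vertex set $\overline V$; $\mathbf P(\Gamma)\otimes_{\mathbb F_1}k$ is the projective space over $k$ with one homogeneous coordinate $X_w$ for each $w\in\overline V$, and each $w\in\overline V$ is identified with the corresponding coordinate point. For $v\in V$, the local affine space $\mathbb A_v\subset\mathbf P(\Gamma)\otimes_{\mathbb F_1}k$, of dimension $\deg(v)$ (the number of edges incident with $v$), is given by $X_v\ne0$ and $X_w=0$ for every $w\in\overline V\setminus\{v\}$ not adjacent to $v$ in $\overline\Gamma$. An edge with no vertices gives a multiplicative group (both added-end coordinates nonzero, all others $0$). $\mathcal F(\Gamma)\otimes_{\mathbb F_1}k$ is the union of all these pieces. Resolution: for an edge $e=xy$ with two distinct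 vertices, $\Gamma_{xy}$ is the loose graph obtained from $\Gamma$ by deleting $e$ and adding two new loose edges, one incident only with $x$ and one incident only with $y$; $\mathbf P(\Gamma)$ is a subspace of $\mathbf P(\Gamma_{xy})$ (two more coordinates). ''Changes when one resolves $xy$'' compares the intersection of the spaces $\mathbb A_s$ formed for $\Gamma$ with the one formed for $\Gamma_{xy}$. $\mathrm d(\cdot,\cdot)$ is the graph distance on $V$, and $\overline{\mathbf B}(c,1)=\{v\in V\mid \mathrm d(c,v)\le1\}$.
   Formalization: ''Changes'' is taken up to isomorphism of k-schemes; for change as a subspace of P(Γ_xy) the balls also include added ends of loose edges at x, y (else false: S={x}, a loose edge at x). S is nonempty, and two distinct vertices lie on at most one edge. *)

(* Defs.v *)
From HB Require Import structures.
From mathcomp Require Import all_boot all_order all_algebra.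
Set Implicit Arguments.
Unset Strict Implicit.
Unset Printing Implicit Defensive.
Import GRing.Theory.
Local Open Scope ring_scope.

(* No two edges share two distinct vertices: this is what makes the local
   affine space at [v] have dimension [deg v].  A vertex may still carry any
   number of edges incident only with it. *)
Record looseGraph := LooseGraph {
  vert : finType;
  edge : finType;
  inc : vert -> edge -> bool;
  inc_le2 : forall e, (#|[set v | inc v e]| <= 2)%N;
  inc_simple : forall (e f : edge) (u v : vert), u != v ->
    inc u e -> inc v e -> inc u f -> inc v f -> e = f
}.

Section Combinatorics.
Variable G : looseGraph.

Definition ends (e : edge G) : {set vert G} := [set v | inc v e].

Definition adj (u v : vert G) : bool :=
  (u != v) && [exists e : edge G, inc u e && inc v e].

Definition inc_sum (a b : vert G + edge G) : bool :=
  match a, b with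
  | inl v, inr e | inr e, inl v => inc v e
  | _, _ => false
  end.

Definition lg_connected : Prop :=
  forall a b : vert G + edge G, connect inc_sum a b.

(* Vertices that are not joined by a path get the value #|V|. *)
Definition dist (u v : vert G) : nat :=
  find (fun n => [exists p : n.-tuple (vert G), path adj u p && (last u p == v)])
       (iota 0 #|vert G|).

Definition cball (c : vert G) (n : nat) : {set vert G} :=
  [set v | dist c v <= n]%N.

(* An edge with j vertices receives 2 - j new ones. *)
Definition bar_vert : finType :=
  (vert G + {e : edge G & 'I_(2 - #|ends e|)})%type.

Definition bar_inc (w : bar_vert) (e : edge G) : bool :=
  match w with
  | inl v => inc v e
  | inr p => tag p == e
  end.

Lemma bar_inc_le2 (e : edge G) : (#|[set w | bar_inc w e]| <= 2)%N.
Proof.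
have -> : [set w | bar_inc w e] =
    [set inl v | v in ends e]
    :|: [set inr (Tagged (fun e => 'I_(2 - #|ends e|)) i)
        | i : 'I_(2 - #|ends e|)].
  apply/setP=> w; rewrite !inE; apply/idP/orP.
    case: w => [v /= ve|[f i] /= /eqP fe].
      by left; apply/imsetP; exists v; rewrite ?inE.
    by subst f; right; apply/imsetP; exists i.
  case=> /imsetP[z zP ->] /=; last by [].
  by move: zP; rewrite inE.
apply: leq_trans (leq_card_setU _ _) _.
apply: leq_trans (leq_add (leq_imset_card _ _) (leq_imset_card _ _)) _.
by rewrite cardT size_enum_ord subnKC //; exact: inc_le2.
Qed.

Lemma bar_inc_simple (e f : edge G) (u v : bar_vert) : u != v ->
  bar_inc u e -> bar_inc v e -> bar_inc u f -> bar_inc v f -> e = f.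
Proof.
case: u => [u|p]; last by move=> _ /eqP <- _ /eqP <-.
case: v => [v|p]; last by move=> _ _ /eqP <- _ /eqP <-.
by move=> uv; apply: inc_simple; apply: contraNneq uv => ->.
Qed.

Definition bar : looseGraph := LooseGraph bar_inc_le2 bar_inc_simple.

Definition res_inc (e : edge G) (x y : vert G)
    (v : vert G) (f : {f : edge G | f != e} + bool) : bool :=
  match f with
  | inl f => inc v (val f)
  | inr b => v == (if b then y else x)
  end.
Arguments res_inc : clear implicits.

Lemma res_inc_le2 e x y f : (#|[set v | res_inc e x y v f]| <= 2)%N.
Proof.
case: f => [f|b] /=; first exact: inc_le2.
by rewrite (_ : [set v | _] = [set (if b then y else x)]) ?cards1 //;
  apply/setP=> v; rewrite !inE.
Qed.

Lemma res_inc_simple e x y (f g : {f : edge G | f != e} + bool)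
    (u v : vert G) : u != v ->
  res_inc e x y u f -> res_inc e x y v f ->
  res_inc e x y u g -> res_inc e x y v g -> f = g.
Proof.
move=> uv; case: f => [f|b] /=; last first.
  by move=> /eqP uE /eqP vE; rewrite uE vE eqxx in uv.
case: g => [g|b] /=; last first.
  by move=> _ _ /eqP uE /eqP vE; rewrite uE vE eqxx in uv.
by move=> uf vf ug vg; congr inl; apply/val_inj/(inc_simple uv).
Qed.

Definition resolve (e : edge G) (x y : vert G) : looseGraph :=
  LooseGraph (@res_inc_le2 e x y) (@res_inc_simple e x y).

End Combinatorics.

(* Schemes are represented by their functors of points on commutative
   k-algebras.  An R-point of P(G) at which some coordinate is invertible is a
   family of homogeneous coordinates up to a unit of R; all the subschemes
   compared below consist of such points. *)
Definition coords (G : looseGraph) (R : Type) : Type :=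
  {ffun vert (bar G) -> R}.

Definition projeq (G : looseGraph) (R : comUnitRingType) (X Y : coords G R) :
    Prop :=
  exists2 u : R, u \is a GRing.unit & forall w, Y w = u * X w.

Section Schemes.
Variable k : fieldType.

Definition subscheme (G : looseGraph) : Type :=
  forall R : comUnitAlgType k, coords G R -> Prop.

Definition local_affine (G : looseGraph) (v : vert G) : subscheme G :=
  fun R X =>
    X (inl v) \is a GRing.unit /\
    forall w : vert (bar G), w != inl v -> ~~ @adj (bar G) (inl v) w -> X w = 0.

Definition inter_affine (G : looseGraph) (S : {set vert G}) : subscheme G :=
  fun R X => forall s, s \in S -> local_affine s X.

(* The projective subspace generated by the coordinate points in [B]. *)
Definition proj_span (G : looseGraph) (B : {set vert (bar G)}) : subscheme G :=
  fun R X => exists c : vert (bar G) -> R,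
    forall w, X w = \sum_(b in B) c b * (w == b)%:R.

Definition sub_contained (G : looseGraph) (A B : subscheme G) : Prop :=
  forall (R : comUnitAlgType k) (X : coords G R), A R X -> B R X.

Definition map_coords (G : looseGraph) (R R' : comUnitAlgType k)
    (phi : {lrmorphism R -> R'}) (X : coords G R) : coords G R' :=
  [ffun w => phi (X w)].

(* Isomorphism of k-schemes, as a natural bijection between functors of
   points. *)
Definition scheme_iso (G H : looseGraph) (A : subscheme G) (B : subscheme H) :
    Prop :=
  exists f : forall R : comUnitAlgType k, coords G R -> coords H R,
  [/\ forall (R : comUnitAlgType k) (X : coords G R), A R X -> B R (f R X),
      forall (R : comUnitAlgType k) (X Y : coords G R), A R X -> A R Y ->
        (projeq X Y <-> projeq (f R X) (f R Y)),
      forall (R : comUnitAlgType k) (Z : coords H R), B R Z ->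
        exists2 X : coords G R, A R X & projeq (f R X) Z
    & forall (R R' : comUnitAlgType k) (phi : {lrmorphism R -> R'})
        (X : coords G R), A R X ->
        projeq (f R' (map_coords phi X)) (map_coords phi (f R X))].

(* The inclusion of P(G) in P(G_xy), for an edge [e] with two vertices (so that
   no coordinate of P(G) belongs to an added end of [e]): extension by 0. *)
Definition embed_fun (G : looseGraph) (e : edge G) (x y : vert G)
    (R : comUnitAlgType k) (X : coords G R)
    (w : bar_vert (resolve e x y)) : R :=
  match w with
  | inl v => X (inl v)
  | inr (existT (inl f) i) =>
      X (inr (existT (fun f : edge G => 'I_(2 - #|ends f|)) (val f) i))
  | inr (existT (inr _) _) => 0
  end.

Definition embed (G : looseGraph) (e : edge G) (x y : vert G)
    (R : comUnitAlgType k) (X : coords G R) : coords (resolve e x y) R :=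
  [ffun w => embed_fun X w].

(* Equality of [A] and [B] inside P(G_xy).  This is finer than [scheme_iso]:
   resolving xy moves the space A_x inside P(G_xy), but A_x stays an affine
   space of dimension [deg x].  If x has a loose edge, A_x is not contained in
   the span of vertices of G alone, so for this finer comparison the balls
   have to be taken in [bar G]. *)
Definition same_in_resolution (G : looseGraph) (e : edge G) (x y : vert G)
    (A : subscheme G) (B : subscheme (resolve e x y)) : Prop :=
  forall (R : comUnitAlgType k) (Z : coords (resolve e x y) R),
    B R Z <-> exists2 X : coords G R, A R X & projeq (embed e x y X) Z.

End Schemes.

(* Main.v *)
(* The intersection of the [A_s] over [S] is cut out by the closed
   neighbourhoods [N[s]] in [bar G], and resolving xy alters [N[s]] only for
   [s = x] and [s = y].  If [S] avoids x and y nothing changes.  If [S] is {x},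
   the space stays an affine space of dimension [deg x]: the coordinate of y is
   traded for that of the new end at x, and [A_x] lies in the span of the ball
   of [bar G] around x.  If [S] contains x and a further vertex s, no added end
   is adjacent to both x and s, so the intersection already lies in the span of
   the ball of G around x. *)
Require Import Defs.
From HB Require Import structures.
From mathcomp Require Import all_boot all_order all_algebra.
Set Implicit Arguments.
Unset Strict Implicit.
Unset Printing Implicit Defensive.
Import GRing.Theory.
Local Open Scope ring_scope.

(** * Closed neighbourhoods, balls of radius one and added ends *)

Definition closed_nbh (G : looseGraph) (s : vert G) (w : vert (bar G)) : bool :=
  (w == inl s) || @adj (bar G) (inl s) w.

Lemma mem_cball1 (G : looseGraph) (u v : vert G) :
  (v == u) || adj u v -> v \in cball u 1.
Proof.
rewrite inE /dist => uv.
(* A failing [find] returns the length [#|vert G|], so with at most one vertex the bound 1 is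
   automatic; otherwise lengths 0 and 1 are both searched. *)
case: #|vert G| => [|[|n]] //=; case: ifP => //= p0; case: ifP => // p1.
case/orP: uv => [/eqP vu|uv].
  by move/existsP: p0; case; exists [tuple]; rewrite /= vu.
by move/existsP: p1; case; exists [tuple v]; rewrite /= uv eqxx.
Qed.

Lemma adj_bar_inl (G : looseGraph) (u v : vert G) :
  @adj (bar G) (inl u) (inl v) = adj u v.
Proof. by []. Qed.

Lemma adj_bar_inr (G : looseGraph) (u : vert G)
    (p : {e : edge G & 'I_(2 - #|ends e|)}) :
  @adj (bar G) (inl u) (inr p) = inc u (tag p).
Proof.
apply/andP/idP=> [[_ /existsP[f /andP[/= uf /eqP ->]]] //|up]; split=> //.
by apply/existsP; exists (tag p); rewrite /= up eqxx.
Qed.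

Lemma end_of_two (G : looseGraph) (e : edge G) (u v w : vert G) :
  u != v -> inc u e -> inc v e -> inc w e -> (w == u) || (w == v).
Proof.
move=> uv ue ve we; apply/norP=> -[wu wv].
have := inc_le2 e; rewrite leqNgt => /negP; apply.
have sub : w |: [set u; v] \subset [set z | inc z e].
  by apply/subsetP=> z; rewrite !inE => /or3P[] /eqP->.
by apply: leq_trans (subset_leq_card sub); rewrite cardsU1 cards2 !inE negb_or wu wv uv.
Qed.

(** Two distinct ends make [2 - #|ends e|] vanish, so the index type is empty. *)
Lemma no_added_end (G : looseGraph) (e : edge G) (u v : vert G) :
  u != v -> inc u e -> inc v e -> 'I_(2 - #|ends e|) -> False.
Proof.
move=> uv ue ve [i].
have : ([set u; v] \subset ends e).
  by apply/subsetP=> z; rewrite !inE => /orP[] /eqP->.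
by move/subset_leq_card; rewrite cards2 uv -subn_eq0 => /eqP->.
Qed.

(** * Points of the intersections and their supports *)

Section LocalAffine.
Variables (k : fieldType) (G : looseGraph) (R : comUnitAlgType k).
Implicit Types (X : coords G R) (S : {set vert G}).

Lemma local_affineP s X :
  local_affine s X <->
  X (inl s) \is a GRing.unit /\ forall w, ~~ closed_nbh s w -> X w = 0.
Proof.
split=> -[Xs X0]; split=> // w.
  by rewrite negb_or => /andP[]; apply: X0.
by move=> ws sw; apply: X0; rewrite negb_or ws.
Qed.

Lemma inter_affine_eq0 S s X w :
  inter_affine S X -> s \in S -> ~~ closed_nbh s w -> X w = 0.
Proof. by move=> XS /XS /local_affineP[_]; apply. Qed.

Lemma inter_affine_projeq S X Y :
  projeq X Y -> inter_affine S X -> inter_affine S Y.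
Proof.
move=> [u u_unit YX] XS s /XS [Xs X0]; split=> [|w ws sw].
  by rewrite YX unitrM u_unit.
by rewrite YX X0 ?mulr0.
Qed.

Lemma proj_span_supp (B : {set vert (bar G)}) X :
  (forall w, w \notin B -> X w = 0) -> @proj_span k G B R X.
Proof.
move=> X0; exists X => w; have [wB|wB] := boolP (w \in B).
  rewrite (bigD1 w) //= eqxx mulr1 big1 ?addr0 // => b /andP[_].
  by rewrite eq_sym => /negPf->; rewrite mulr0.
rewrite X0 // big1 // => b bB.
by rewrite (_ : (w == b) = false) ?mulr0 //; apply: contraNF wB => /eqP->.
Qed.

End LocalAffine.

Lemma inter_affine_sub_bar_ball (k : fieldType) (G : looseGraph)
    (S : {set vert G}) (z : vert G) (B : {set vert (bar G)}) :
  z \in S -> @cball (bar G) (inl z) 1 \subset B ->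
  sub_contained (@inter_affine k G S) (@proj_span k G B).
Proof.
move=> zS zB R X XS; apply: proj_span_supp => w wB.
apply: inter_affine_eq0 XS zS _; apply: contra wB => zw.
exact: (subsetP zB) (mem_cball1 zw).
Qed.

(** The neighbourhood of [z] confines the support to its ball and to added ends at [z]. The second
    member [s] excludes those: an edge meeting both [z] and [s] has no added end. *)
Lemma inter_affine_sub_ball (k : fieldType) (G : looseGraph)
    (S : {set vert G}) (z s : vert G) (B : {set vert G}) :
  z \in S -> s \in S -> s != z -> cball z 1 \subset B ->
  sub_contained (@inter_affine k G S) (@proj_span k G [set inl v | v in B]).
Proof.
move=> zS sS sz zB R X XS; apply: proj_span_supp => w wB.
have [zw|/(inter_affine_eq0 XS zS) //] := boolP (closed_nbh z w).
have [sw|/(inter_affine_eq0 XS sS) //] := boolP (closed_nbh s w).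
case: w zw sw wB => [v zv _ /imsetP[]|[f i]].
  by exists v => //; apply: (subsetP zB); apply: mem_cball1.
rewrite /closed_nbh !adj_bar_inr /= => zf sf.
by case: (no_added_end sz sf zf i).
Qed.

(** * Isomorphisms obtained by renaming coordinates *)

Definition relabel (G H : looseGraph) (R : nmodType)
    (h : vert (bar H) -> option (vert (bar G))) (X : coords G R) : coords H R :=
  [ffun w => oapp X 0 (h w)].

Lemma relabel_projeq (G H : looseGraph) (R : comUnitRingType)
    (h : vert (bar H) -> option (vert (bar G))) (X Y : coords G R) :
  projeq X Y -> projeq (relabel h X) (relabel h Y).
Proof.
move=> [u u_unit YX]; exists u => // w.
by rewrite !ffunE; case: (h w) => [v|] /=; rewrite ?YX ?mulr0.
Qed.

Lemma projeqxx (G : looseGraph) (R : comUnitRingType) (X : coords G R) :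
  projeq X X.
Proof. by exists 1 => [|w]; rewrite ?unitr1 ?mul1r. Qed.

(** Renaming, or filling in zeros, respects scaling and commutes with every morphism of algebras;
    relabelling back along [g] shows that projective equality is also reflected. *)
Lemma relabel_iso (k : fieldType) (G H : looseGraph)
    (A : subscheme k G) (B : subscheme k H)
    (h : vert (bar H) -> option (vert (bar G)))
    (g : vert (bar G) -> option (vert (bar H))) :
  (forall R X, A R X -> B R (relabel h X)) ->
  (forall R Z, B R Z -> A R (relabel g Z)) ->
  (forall R X, A R X -> relabel g (relabel h X) = X) ->
  (forall R Z, B R Z -> relabel h (relabel g Z) = Z) ->
  scheme_iso A B.
Proof.
move=> AB BA hK gK; exists (fun R => @relabel G H R h).
split=> [R X|R X Y AX AY|R Z BZ|R R' phi X _].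
- exact: AB.
- split=> [|/(relabel_projeq g)]; first exact: relabel_projeq.
  by rewrite !hK.
- by exists (relabel g Z); [exact: BA | rewrite gK //; exact: projeqxx].
- rewrite (_ : map_coords _ _ = relabel h (map_coords phi X)).
    exact: projeqxx.
  by apply/ffunP=> w; rewrite !ffunE; case: (h w) => [v|] /=;
    rewrite ?ffunE ?raddf0.
Qed.

(** * Renaming coordinates along a resolution *)

Section Resolution.
Variables (G : looseGraph) (e : edge G) (x y : vert G).
Hypotheses (neq_xy : x != y) (xe : inc x e) (ye : inc y e).
Local Notation H := (resolve e x y).
Local Notation endpoint b := (if b then y else x).

Lemma inc_endpoint b : inc (endpoint b) e.
Proof. by case: b. Qed.

Lemma neq_endpoint b : endpoint b != endpoint (~~ b).
Proof. by case: b => /=; [rewrite eq_sym|]; exact: neq_xy. Qed.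

(** The new edges have one vertex each and join nothing; by simplicity [e] is the only edge between
    its ends, so deleting it separates them. *)
Lemma adj_resolve (u v : vert G) :
  @adj H u v = adj u v && ~~ (inc u e && inc v e).
Proof.
rewrite /adj -andbA; apply: andb_id2l => uv; apply/existsP/andP.
  case=> -[f|b] /andP[/= uf vf]; last first.
    by rewrite (eqP uf) (eqP vf) eqxx in uv.
  split; first by apply/existsP; exists (val f); rewrite uf.
  apply: contra (valP f) => /andP[ue ve].
  by apply/eqP/(@inc_simple G _ _ _ _ uv).
case=> /existsP[f /andP[uf vf]] uve.
have fe : f != e by apply: contraNneq uve => <-; rewrite uf.
by exists (inl (exist _ f fe)); rewrite /= uf.
Qed.

Lemma card_new_ends b : #|@ends H (inr b)| = 1%N.
Proof.
by rewrite (_ : @ends H (inr b) = [set endpoint b]) ?cards1 //;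
  apply/setP=> v; rewrite !inE.
Qed.

(** Under [Some b] the new end at [endpoint b] takes over the coordinate of this vertex, which is
    left without a partner in the resolution. *)
Definition moved (o : option bool) (v : vert G) : bool :=
  if o is Some b then v == endpoint (~~ b) else false.

(* [None] is the inclusion of P(G) in P(G_xy); [Some b] renames the endpoint of
   [e] other than [endpoint b] as the new end at [endpoint b]. *)
Definition old_coord (o : option bool) (w : vert (bar H)) :
    option (vert (bar G)) :=
  match w with
  | inl v => if moved o v then None else Some (inl v)
  | inr (existT (inl f) i) =>
      Some (inr (existT (fun f : edge G => 'I_(2 - #|ends f|)) (val f) i))
  | inr (existT (inr b) _) =>
      if o == Some b then Some (inl (endpoint (~~ b))) else None
  end.

(** The delicate clash is between a renamed new end and the vertex whose coordinate it takes;
    [moved] has removed that vertex from the domain. *)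
Lemma old_coord_inj o w w' u :
  old_coord o w = Some u -> old_coord o w' = Some u -> w = w'.
Proof.
case: w w' => [v|[[f|b] i]] [v'|[[f'|b'] i']] //=.
- by case: ifP => // _ [<-]; case: ifP => // _ [->].
- by case: ifP => // _ [<-].
- case: ifP => // vo [<-]; case: ifP => // /eqP oE [vE].
  by move: vo; rewrite oE -vE /= eqxx.
- by move=> [<-]; case: ifP.
- case: f f' i i' => [f fe] [f' fe'] i i' /= [<-] [fE]; subst f'.
  move/eqP; rewrite eq_Tagged /= => /eqP ->.
  by rewrite (bool_irrelevance fe fe').
- by move=> [<-]; case: ifP.
- case: ifP => // /eqP oE [<-]; case: ifP => // vo [vE].
  by move: vo; rewrite oE vE /= eqxx.
- by case: ifP => // _ [<-].
- case: ifP => // /eqP -> [<-]; case: eqP => // -[bb] _; subst b'.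
  (* A new edge has one vertex, hence one added end: both indices lie below [2 - 1]. *)
  congr (inr (Tagged _ _)); apply/val_inj.
  case: i i' => [i lti] [i' lti'] /=.
  by move: lti lti'; rewrite !card_new_ends; case: i i' => [|?] [|?].
Qed.

Definition new_coord o (u : vert (bar G)) : option (vert (bar H)) :=
  [pick w | old_coord o w == Some u].

(** * A criterion for a renaming to identify the two intersections *)

Variable S : {set vert G}.
Variable o : option bool.
Hypothesis S_fixed : forall s, s \in S -> ~~ moved o s.
Hypothesis nbh_old_coord : forall s w u, s \in S -> old_coord o w = Some u ->
  @closed_nbh H s w = closed_nbh s u.
Hypothesis old_coord_None : forall w, old_coord o w = None ->
  exists2 s, s \in S & ~~ @closed_nbh H s w.
Hypothesis old_coord_onto : forall u, exists w, old_coord o w = Some u.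

Lemma new_coordK u : exists2 w, new_coord o u = Some w & old_coord o w = Some u.
Proof.
rewrite /new_coord; case: pickP => [w /eqP|noW]; first by exists w.
by have [w wu] := old_coord_onto u; move: (noW w); rewrite wu eqxx.
Qed.

Section Points.
Variables (k : fieldType) (R : comUnitAlgType k).
Implicit Types (X : coords G R) (Z : coords H R).

Lemma old_coord_fixed s : s \in S -> old_coord o (inl s) = Some (inl s).
Proof. by move=> /S_fixed/negPf /= ->. Qed.

Lemma relabel_oldK X : relabel (new_coord o) (relabel (old_coord o) X) = X.
Proof.
apply/ffunP=> u; rewrite ffunE.
by have [w -> wu] := new_coordK u; rewrite /= ffunE wu.
Qed.

(** Only coordinates without a partner could be lost, and [old_coord_None] makes them vanish on this
    intersection. *)
Lemma relabel_newK Z : @inter_affine k H S R Z ->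
  relabel (old_coord o) (relabel (new_coord o) Z) = Z.
Proof.
move=> ZS; apply/ffunP=> w; rewrite ffunE.
case wu: (old_coord o w) => [u|] /=.
  rewrite ffunE; have [w' -> w'u] := new_coordK u.
  by rewrite /= (old_coord_inj wu w'u).
by have [s sS sw] := old_coord_None wu; rewrite (inter_affine_eq0 ZS sS sw).
Qed.

Lemma relabel_old_affine X :
  @inter_affine k G S R X -> @inter_affine k H S R (relabel (old_coord o) X).
Proof.
move=> XS s sS; have /local_affineP[Xs X0] := XS s sS.
apply/local_affineP; split=> [|w sw]; rewrite ffunE.
  by rewrite old_coord_fixed.
by case wu: (old_coord o w) => [u|] //=; apply: X0; rewrite -(nbh_old_coord sS wu).
Qed.

Lemma relabel_new_affine Z :
  @inter_affine k H S R Z -> @inter_affine k G S R (relabel (new_coord o) Z).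
Proof.
move=> ZS s sS; have /local_affineP[Zs Z0] := ZS s sS.
apply/local_affineP; split=> [|u su]; rewrite ffunE.
  have [w -> ws] := new_coordK (inl s).
  by rewrite /= (old_coord_inj ws (old_coord_fixed sS)).
have [w -> wu] := new_coordK u.
by rewrite /=; apply: Z0; rewrite (nbh_old_coord sS wu).
Qed.

End Points.

Lemma resolve_iso (k : fieldType) :
  scheme_iso (@inter_affine k G S) (@inter_affine k H S).
Proof.
apply: (@relabel_iso _ _ _ _ _ (old_coord o) (new_coord o)) => R.
- exact: relabel_old_affine.
- exact: relabel_new_affine.
- by move=> X _; exact: relabel_oldK.
- exact: relabel_newK.
Qed.

(** For [None] the relabelling is [embed] itself, so the bijection on points becomes an equality
    inside the larger projective space. *)
Lemma resolve_same (k : fieldType) :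
  o = None -> same_in_resolution (@inter_affine k G S) (@inter_affine k H S).
Proof.
move=> oN R Z; have embedE X : embed e x y X = relabel (old_coord o) X.
  by apply/ffunP=> -[v|[[f|b] i]]; rewrite !ffunE /= ?oN.
split=> [ZS|[X XS XZ]].
  exists (relabel (new_coord o) Z); first exact: relabel_new_affine.
  by rewrite embedE relabel_newK //; exact: projeqxx.
apply: inter_affine_projeq XZ _.
by rewrite embedE; apply: relabel_old_affine.
Qed.

End Resolution.

(** * The cases: [S] avoiding both endpoints, or consisting of one *)

Section Cases.
Variables (k : fieldType) (G : looseGraph) (e : edge G) (x y : vert G).
Hypotheses (neq_xy : x != y) (xe : inc x e) (ye : inc y e).
Variable S : {set vert G}.
Local Notation H := (resolve e x y).
Local Notation endpoint b := (if b then y else x).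

(** The edge [e] has no added end, so the edge carrying [i] survives the resolution. *)
Lemma old_coord_old_end o (f : edge G) (i : 'I_(2 - #|ends f|)) :
  exists w : vert (bar H), old_coord o w = Some (inr (Tagged _ i)).
Proof.
have fe : f != e.
  by apply/eqP=> fe; subst f; exact: no_added_end neq_xy xe ye i.
by exists (inr (existT _ (inl (exist _ f fe)) i)).
Qed.

Section Away.
Hypotheses (S_neq0 : S != set0) (xS : x \notin S) (yS : y \notin S).

Let S_away s : s \in S -> inc s e = false.
Proof.
move=> sS; apply/negP=> /(end_of_two neq_xy xe ye).
by case/orP=> /eqP sE; move: xS yS; rewrite -sE sS.
Qed.

Let nbh_away s (w : vert (bar H)) u :
  s \in S -> old_coord None w = Some u -> @closed_nbh H s w = closed_nbh s u.
Proof.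
move=> sS; case: w => [v|[[f|b] i]] //= [<-]; rewrite /closed_nbh.
  by rewrite !adj_bar_inl adj_resolve S_away // andbT.
by rewrite !adj_bar_inr.
Qed.

(** The new ends are the coordinates without a partner; each is adjacent only to [x] or to [y], so
    any member of [S] serves. *)
Let None_away (w : vert (bar H)) : old_coord None w = None ->
  exists2 s, s \in S & ~~ @closed_nbh H s w.
Proof.
case: w => [v|[[f|b] i]] //= _; have [s sS] := set0Pn _ S_neq0.
exists s => //; rewrite /closed_nbh adj_bar_inr /=.
by apply/eqP=> sE; move: xS yS; rewrite sE in sS; case: b sS {i sE} => ->.
Qed.

Let onto_away u : exists w : vert (bar H), old_coord None w = Some u.
Proof.
by case: u => [v|[f i]]; [exists (inl v) | exact: old_coord_old_end].
Qed.

Lemma away_iso : scheme_iso (@inter_affine k G S) (@inter_affine k H S).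
Proof. exact: (resolve_iso (o := None)). Qed.

Lemma away_same :
  same_in_resolution (@inter_affine k G S) (@inter_affine k H S).
Proof. exact: (resolve_same (o := None)). Qed.

End Away.

Lemma endpoint_iso b : S = [set endpoint b] ->
  scheme_iso (@inter_affine k G S) (@inter_affine k H S).
Proof.
have zz := neq_endpoint neq_xy b; have ze := inc_endpoint xe ye.
move=> ->; apply: (resolve_iso (o := Some b)) => [s|s w u|w|u].
- by move/set1P->.
- move/set1P->; case: w => [v|[[f|b'] i]] /=.
  (* A vertex that is not moved and differs from [endpoint b] is not on [e], so its adjacency
     survives. *)
  + case: ifP => // vz [<-]; rewrite /closed_nbh !adj_bar_inl adj_resolve.
    have [->|vz' /=] := eqVneq v (endpoint b); first by rewrite !eqxx.
    rewrite (_ : @inc G v e = false) ?andbF ?andbT //.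
    by apply/negP=> /(end_of_two zz (ze _) (ze _)); rewrite vz (negPf vz').
  + by case=> <-; rewrite /closed_nbh !adj_bar_inr.
  (* The new end stands for the other endpoint, which was adjacent through [e]. *)
  + case: eqP => // -[bb] [<-]; subst b'; rewrite /closed_nbh adj_bar_inr adj_bar_inl /=.
    rewrite eqxx /adj zz /=; apply/esym/orP; right.
    by apply/existsP; exists e; rewrite !ze.
- move=> wN; exists (endpoint b); first exact: set11.
  (* Without a partner are the other endpoint, now cut off from [endpoint b], and the new end
     located there. *)
  case: w wN => [v|[[f|b'] i]] //=.
  + case: eqP => // -> _; rewrite /closed_nbh adj_bar_inl adj_resolve !ze andbF.
    by rewrite orbF; apply: contra zz => /eqP[->].
  + rewrite /closed_nbh adj_bar_inr /=.
    by case: eqP => // bb _; case: b b' bb zz {i} => -[].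
- case: u => [v|[f i]]; last exact: old_coord_old_end.
  have [->|vz] := eqVneq v (endpoint (~~ b)); last first.
    by exists (inl v); rewrite /= (negPf vz).
  have lt0 : (0 < 2 - #|@ends H (inr b)|)%N by rewrite card_new_ends.
  by exists (inr (existT _ (inr b) (Ordinal lt0))); rewrite /= eqxx.
Qed.

End Cases.

Theorem theorem11p7 (G : looseGraph) (connG : lg_connected G)
    (e : edge G) (x y : vert G) (neq_xy : x != y) (xe : inc x e) (ye : inc y e)
    (S : {set vert G}) (S_neq0 : S != set0) (k : finFieldType) :
  let AS : subscheme k G := @inter_affine k G S in
  let AS' : subscheme k (resolve e x y) :=
    @inter_affine k (resolve e x y) S in
  (~ scheme_iso AS AS' ->
     sub_contained AS
       (@proj_span k G [set inl v | v in cball x 1 :|: cball y 1]))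
  /\
  (~ same_in_resolution AS AS' ->
     sub_contained AS
       (@proj_span k G (@cball (bar G) (inl x) 1 :|: @cball (bar G) (inl y) 1))).
Proof.
move=> AS AS'.
have [/existsP[b zS]|/existsPn noz] :=
    boolP [exists b : bool, (if b then y else x) \in S]; last first.
  have xS := noz false; have yS := noz true.
  by split=> -[]; [apply: away_iso | apply: away_same].
(* Stated for any [K] because it is applied both to [G] and to [bar G]. *)
have ball (K : looseGraph) (u v : vert K) :
    cball (if b then v else u) 1 \subset cball u 1 :|: cball v 1.
  by case: b {zS}; rewrite ?subsetUl ?subsetUr.
split=> [not_iso|_].
  (* If [S] is a single endpoint, [endpoint_iso] contradicts the assumed change; otherwise a second
     member [s] is available. *)
  have [S1|/set0Pn[s]] := eqVneq (S :\ (if b then y else x)) set0.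
    case: not_iso; apply: (@endpoint_iso _ _ _ _ _ neq_xy xe ye _ b).
    by rewrite -(setD1K zS) S1 setU0.
  rewrite in_setD1 => /andP[sz sS].
  exact: inter_affine_sub_ball zS sS sz (ball _ _ _).
apply: inter_affine_sub_bar_ball zS _.
by have := ball (bar G) (inl x) (inl y); case: (b).
Qed.
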